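(* Let $n\ge 1$, let $\beta\in B_n$ be an arbitrary braid with exponent sum $w$, and let $h_0,\dots,h_{n-1}$ be its Laurent MFW polynomials, so that $P_{\widehat\beta}(v,z)=v^{w-n+1}\sum_{j=0}^{n-1}h_j(z)v^{2j}$. Then: (i) $h_0=z^{-2}\{C_{w+4-n}-\nabla_{\widehat\beta}\}-q_0$, with $q_0=\sum_{j=3}^{n-1}z^{-2}(C_{2j-3}-1)\,h_j$; (ii) $h_1=\nabla_{\widehat\beta}-h_0-h_2-q_1$, with $q_1=\sum_{j=3}^{n-1}h_j$; (iii) $h_2=z^{-2}\{C_{w+2-n}-\nabla_{\widehat\beta}\}-q_2$, with $q_2=\sum_{j=3}^{n-1}z^{-2}(C_{2j-1}-1)\,h_j$.
   Context: $B_n$ is the braid group on $n$ strands with standard generators $\sigma_1,\dots,\sigma_{n-1}$; $\widehat\beta$ is the oriented link obtained by the standard closure of $\beta$; $w=w(\beta)$ is the exponent sum (writhe) of $\beta$ (it is $0$ when $n=1$). The Homflypt polynomial $P_L(v,z)$ of an oriented link $L$ is determined by $P=1$ on the unknot and $P_{D_+}=vz\,P_{D_0}+v^2P_{D_-}$ for diagrams differing at one crossing (positive, smoothed, negative). The Conway polynomial is $\nabla_L(z)=P_L(1,z)$. For every integer $p$, $C_p=C_p(z)$ is the Conway polynomial of the closure of $\sigma_1^p\in B_2$; equivalently $C_0=0$, $C_1=1$, $C_{p+1}=zC_p+C_{p-1}$ for all $p\in\mathbb Z$. For $\beta\in B_n$ one can write uniquely $P_{\widehat\beta}(v,z)=v^{w-n+1}\sum_{j=0}^{n-1}h_j(z)v^{2j}$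 with $h_j\in\mathbb Z[z,z^{-1}]$ (a consequence of the Morton-Franks-Williams inequality); the $h_j$ (possibly zero) are the Laurent MFW polynomials of $\beta$. For $n<3$, $h_j$ with $j\ge n$ is read as $0$. Empty sums are $0$. *)

(* Defs.v *)
From HB Require Import structures.
From mathcomp Require Import all_boot all_order all_algebra.
From mathcomp Require Import finmap.
From mathcomp.multinomials Require Import monalg.

Set Implicit Arguments.
Unset Strict Implicit.
Unset Printing Implicit Defensive.

Import Order.TTheory GRing.Theory Num.Theory.
Local Open Scope ring_scope.

(* Laurent polynomials in one variable over R: finitely supported families    *)
(* of coefficients indexed by [int] (the module [{malg R[int]}], where [f@_k] *)
(* is the coefficient of degree k), with the convolution product. The product *)
(* is not inherited from [monalg], which only multiplies over monoids without *)
(* nontrivial units.                                                          *)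
Definition laurent (R : comNzRingType) : Type := {malg R[int]}.

HB.instance Definition _ (R : comNzRingType) := Choice.on (laurent R).
HB.instance Definition _ (R : comNzRingType) := GRing.Zmodule.on (laurent R).

Section LaurentRing.
Variable R : comNzRingType.
Implicit Types (f g h : laurent R) (a b : R) (k l : int).

Definition lterm a k : laurent R := << a *g k >>.

Definition lmul f g : laurent R :=
  \sum_(k <- msupp f) \sum_(l <- msupp g) lterm (f@_k * g@_l) (k + l).

Lemma lterm0 k : lterm 0 k = 0.
Proof. exact: raddf0. Qed.

Lemma ltermD a b k : lterm (a + b) k = lterm a k + lterm b k.
Proof. exact: raddfD. Qed.

Lemma ltermE f : f = \sum_(k <- msupp f) lterm f@_k k.
Proof. exact: monalgE. Qed.

Lemma lmulwl (d : {fset int}) f g : (msupp f `<=` d)%fset ->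
  lmul f g = \sum_(k <- d) \sum_(l <- msupp g) lterm (f@_k * g@_l) (k + l).
Proof.
move=> le; rewrite /lmul (big_fset_incl _ le) // => k _ /mcoeff_outdom ->.
by rewrite big1 // => l _; rewrite mul0r lterm0.
Qed.

Lemma lmulC : commutative lmul.
Proof.
move=> f g; rewrite /lmul exchange_big /=.
by apply: eq_bigr => k _; apply: eq_bigr => l _; rewrite mulrC addrC.
Qed.

Lemma lmulDl : left_distributive lmul +%R.
Proof.
move=> f1 f2 g.
pose d := (msupp f1 `|` msupp f2)%fset.
rewrite (@lmulwl d) ?(msuppD_le) // (@lmulwl d f1) ?fsubsetUl //.
rewrite (@lmulwl d f2) ?fsubsetUr // -big_split /=; apply: eq_bigr => k _.
rewrite -big_split /=; apply: eq_bigr => l _.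
by rewrite mcoeffD mulrDl ltermD.
Qed.

Lemma lmulDr : right_distributive lmul +%R.
Proof. by move=> f g1 g2; rewrite lmulC lmulDl !(lmulC _ f). Qed.

Lemma lmul0l g : lmul 0 g = 0.
Proof. by apply: (addIr (lmul 0 g)); rewrite -lmulDl !add0r. Qed.

Lemma lmul0r f : lmul f 0 = 0.
Proof. by rewrite lmulC lmul0l. Qed.

Lemma lmul_suml I (r : seq I) (F : I -> laurent R) g :
  lmul (\sum_(i <- r) F i) g = \sum_(i <- r) lmul (F i) g.
Proof.
exact: (big_morph (lmul^~ g) (fun f1 f2 => lmulDl f1 f2 g) (lmul0l g)).
Qed.

Lemma lmul_sumr I (r : seq I) (F : I -> laurent R) f :
  lmul f (\sum_(i <- r) F i) = \sum_(i <- r) lmul f (F i).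
Proof. exact: (big_morph (lmul f) (lmulDr f) (lmul0r f)). Qed.

Lemma lmul_term a b k l : lmul (lterm a k) (lterm b l) = lterm (a * b) (k + l).
Proof.
rewrite (@lmulwl [fset k]%fset) ?msuppU_le // big_seq_fset1.
rewrite (big_fset_incl _ (@msuppU_le _ _ l b)) /=.
  by rewrite big_seq_fset1 !mcoeffUU.
by move=> j _ /mcoeff_outdom ->; rewrite mulr0 lterm0.
Qed.

Lemma lmulA : associative lmul.
Proof.
move=> f g h; rewrite (ltermE f) !lmul_suml; apply: eq_bigr => k _.
rewrite (ltermE g) lmul_suml !lmul_sumr lmul_suml; apply: eq_bigr => l _.
rewrite (ltermE h) !lmul_sumr; apply: eq_bigr => m _.
by rewrite !lmul_term mulrA addrA.
Qed.

Lemma lmul1l : left_id (lterm 1 0) lmul.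
Proof.
move=> f; rewrite (ltermE f) lmul_sumr; apply: eq_bigr => k _.
by rewrite lmul_term mul1r add0r.
Qed.

Lemma lterm1_neq0 : lterm 1 0 != 0.
Proof.
apply/eqP => /(congr1 (mcoeff 0)) /eqP.
by rewrite mcoeffUU mcoeff0 oner_eq0.
Qed.

HB.instance Definition _ := GRing.Zmodule_isComNzRing.Build (laurent R)
  lmulA lmulC lmul1l lmulDl lterm1_neq0.

(* Value at 1 of the variable. *)
Definition leval1 f : R := \sum_(k <- msupp f) f@_k.

End LaurentRing.

(* Z[z, 1/z] and Z[v, 1/v, z, 1/z]; the latter is built as Laurent            *)
(* polynomials in v with coefficients in the former, so that P(1, z) is       *)
(* [leval1 P].                                                                *)
Notation Zz := (laurent int).
Notation Zvz := (laurent Zz).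
Definition zpow (k : int) : Zz := lterm 1 k.
Definition vpow (k : int) : Zvz := lterm 1 k.
Definition zconst (c : Zz) : Zvz := lterm c 0.

(* Oriented link diagrams in Morse position, read from bottom to top as a     *)
(* sequence of elementary pieces; [(k, x)] is the piece x with k vertical     *)
(* strands on its left. In [cross e], the strand from bottom left to top      *)
(* right is the over-strand iff e is true. Orientations are recorded at the   *)
(* horizontal levels, true meaning upwards; [cup o] is a local minimum whose  *)
(* left leg has orientation o. The orientations of crossings and of local     *)
(* maxima (caps) are determined by those of the level below.                  *)
Inductive piece := cup of bool | cap | cross of bool.

Definition diagram := seq (nat * piece).

Definition piece_src (x : piece) : nat := if x is cup _ then 0%N else 2%N.
Definition piece_tgt (x : piece) : nat := if x is cap then 0%N else 2%N.

Definition next_level (s : seq bool) (kx : nat * piece) : option (seq bool) :=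
  let: (k, x) := kx in
  match x, drop k s with
  | cup o, t => if (k <= size s)%N then Some (take k s ++ [:: o, ~~ o & t])
                else None
  | cap, [:: a, b & t] => if a != b then Some (take k s ++ t) else None
  | cross _, [:: a, b & t] => Some (take k s ++ [:: b, a & t])
  | _, _ => None
  end.

Definition top_level (D : diagram) : option (seq bool) :=
  foldl (fun os kx => obind (next_level^~ kx) os) (Some [::]) D.

Definition link_diagram (D : diagram) : bool := top_level D == Some [::].

(* Local moves generating isotopy of oriented links: planar isotopy           *)
(* (exchange of the heights of distant pieces, straightening of a strand,     *)
(* passing a crossing around an extremum) and the Reidemeister moves. The     *)
(* condition in [move_R3] says that the three strands are consistently        *)
(* layered.                                                                   *)
Inductive local_move : diagram -> diagram -> Prop :=
| move_exchange k j x y :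
    local_move [:: (k, x); (k + piece_tgt x + j, y)%N]
               [:: (k + piece_src x + j, y)%N; (k, x)]
| move_straighten_r k o : local_move [:: (k, cup o); (k.+1, cap)] [::]
| move_straighten_l k o : local_move [:: (k.+1, cup o); (k, cap)] [::]
| move_cup_cross k o e :
    local_move [:: (k, cup o); (k.+1, cross e)]
               [:: (k.+1, cup o); (k, cross (~~ e))]
| move_cross_cap k e :
    local_move [:: (k, cross e); (k.+1, cap)]
               [:: (k.+1, cross (~~ e)); (k, cap)]
| move_R1_r k o e :
    local_move [:: (k.+1, cup o); (k, cross e); (k.+1, cap)] [::]
| move_R1_l k o e :
    local_move [:: (k, cup o); (k.+1, cross e); (k, cap)] [::]
| move_R2 k e : local_move [:: (k, cross e); (k, cross (~~ e))] [::]
| move_R3 k e1 e2 e3 : (e2 == e1) || (e2 == e3) ->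
    local_move [:: (k, cross e1); (k.+1, cross e2); (k, cross e3)]
               [:: (k.+1, cross e3); (k, cross e2); (k.+1, cross e1)].

(* P takes equal values on diagrams of isotopic links. *)
Definition link_invariant (T : Type) (P : diagram -> T) : Prop :=
  forall D1 L L' D2 : diagram, local_move L L' ->
    link_diagram (D1 ++ L ++ D2) -> link_diagram (D1 ++ L' ++ D2) ->
    P (D1 ++ L ++ D2) = P (D1 ++ L' ++ D2).

Definition unknot : diagram := [:: (0%N, cup true); (0%N, cap)].

(* Oriented smoothing of a crossing whose two lower ends have orientations a  *)
(* and b: if they agree it consists of two vertical strands, otherwise of a   *)
(* cap below a cup.                                                           *)
Definition smoothing (k : nat) (a b : bool) : diagram :=
  if a == b then [::] else [:: (k, cap); (k, cup b)].

(* The Homflypt polynomial: the invariant of oriented links equal to 1 on the *)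
(* unknot and satisfying P(D+) = v z P(D0) + v^2 P(D-). A crossing [cross e]  *)
(* whose lower ends have orientations a and b is positive iff e = (a == b).   *)
Definition homflypt (P : diagram -> Zvz) : Prop :=
  [/\ link_invariant P,
      P unknot = 1
    & forall (D1 D2 : diagram) (s t : seq bool) (a b : bool),
        let D_cross e := D1 ++ (size s, cross e) :: D2 in
        top_level D1 = Some (s ++ [:: a, b & t]) -> link_diagram (D_cross true) ->
        P (D_cross (a == b))
        = vpow 1 * zconst (zpow 1) * P (D1 ++ smoothing (size s) a b ++ D2)
          + vpow 2 * P (D_cross (a != b))].

Definition conway (P : diagram -> Zvz) (D : diagram) : Zz := leval1 (P D).

(* Braid words on n strands: [(i, true)] is the generator exchanging the      *)
(* strands i and i+1, counted from 0, and [(i, false)] is its inverse.        *)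
Definition braid (n : nat) := seq ('I_n.-1 * bool).

Definition writhe n (beta : braid n) : int :=
  \sum_(x <- beta) (if x.2 then 1 else -1).

(* The n strands run upwards and are closed by nested arcs on the right.      *)
Definition braid_closure n (beta : braid n) : diagram :=
  [seq (k, cup true) | k <- iota 0 n]
  ++ [seq (nat_of_ord x.1, cross x.2) | x <- beta]
  ++ [seq (k, cap) | k <- rev (iota 0 n)].

Definition sigma1_pow (p : int) : braid 2 := nseq `|p|%N (ord0, 0 <= p).

(* C_p, the Conway polynomial of the closure of the p-th power of sigma_1.    *)
Definition conwayC (P : diagram -> Zvz) (p : int) : Zz :=
  conway P (braid_closure (sigma1_pow p)).

(* Main.v *)
Require Import Defs.
From mathcomp Require Import all_boot all_order all_algebra.
From mathcomp Require Import finmap zify ring.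
From mathcomp.multinomials Require Import monalg.

Set Implicit Arguments.
Unset Strict Implicit.
Unset Printing Implicit Defensive.

Import Order.TTheory GRing.Theory Num.Theory.
Local Open Scope ring_scope.

(**
The two specialisations of P that matter are v = 1, where P becomes the Conway
polynomial, and 1/v - v = z, where P becomes the constant 1. Each is one linear
relation between the h_j; the second one lives in the free Z[z, 1/z]-module of
rank 2 generated by 1 and v, so it amounts to two scalar relations, and these
three relations can be solved for h_0, h_1 and h_2.

To avoid adjoining a root, let x = 1/v with x^2 = z x + 1. Then x^k =
C_k x + C_(k-1) for every integer k, since C satisfies C_(k+1) = z C_k +
C_(k-1), C_0 = 0 and C_1 = 1. Hence the coefficient of x in x^m F(v), for a
Laurent polynomial F in v with coefficients F_k, is the sum of the F_k C_(m-k),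
and P = 1 under the substitution is equivalent to: this sum equals C_m for
every m ([specializes_to_1]). Applied to the expansion of P with m = w - n + 4 and
m = w - n + 2 it gives the sums of the h_j C_(3-2j) and of the h_j C_(1-2j),
and C_(-k) = C_k for odd k turns them into (i) and (iii). The value at v = 1
is (ii).

It remains to prove the specialisation for closed braids
([closure_specializes]). The constant 1 satisfies the skein relation when
1/v - v = z, because 1 = v z + v^2; since v z and v^2 are units there, the
property passes from any two of the three links of a skein triple to the third.
So it suffices that every closed braid is reached from the unknot by isotopies
and by such two-out-of-three steps ([closure_skein_ind]). This is the argument
behind the trace on Hecke algebras, by induction on the number of strands.
Crossing changes reduce to positive words. A positive word is then brought, by
braid relations and by reducing s_i s_i to s_i and the empty word, to
words containing the last generator at most once
([positive_word_reduction]). If it occurs exactly once, a Reidemeister move I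
removes the last strand ([closure_stab]). If it does not occur, inserting it
with either sign gives two such words, hence the third link of their triple.
The closing arcs are nested and the last strand is innermost, so that it can be
contracted in place.
*)

(** * Linear functionals on Laurent polynomials *)

Section Functional.
Variable R : comNzRingType.
Implicit Types (phi : int -> R) (F G : laurent R).

Definition pairing phi F : R := \sum_(k <- msupp F) F@_k * phi k.

Lemma eq_pairing phi psi F : phi =1 psi -> pairing phi F = pairing psi F.
Proof. by move=> eq_phi; apply: eq_bigr => k _; rewrite eq_phi. Qed.

Lemma pairing_widen (d : {fset int}) phi F : (msupp F `<=` d)%fset ->
  pairing phi F = \sum_(k <- d) F@_k * phi k.
Proof.
move=> le; rewrite /pairing (big_fset_incl _ le) // => k _ /mcoeff_outdom ->.
by rewrite mul0r.
Qed.

Lemma pairingD phi F G : pairing phi (F + G) = pairing phi F + pairing phi G.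
Proof.
pose d := (msupp F `|` msupp G)%fset.
rewrite (@pairing_widen d) ?msuppD_le // (@pairing_widen d _ F) ?fsubsetUl //.
rewrite (@pairing_widen d _ G) ?fsubsetUr // -big_split /=.
by apply: eq_bigr => k _; rewrite mcoeffD mulrDl.
Qed.

Lemma pairing0 phi : pairing phi 0 = 0.
Proof. by rewrite /pairing msupp0 big_seq_fset0. Qed.

Lemma pairing_sum I (r : seq I) phi (F : I -> laurent R) :
  pairing phi (\sum_(i <- r) F i) = \sum_(i <- r) pairing phi (F i).
Proof.
exact: (big_morph (pairing phi) (fun F G => pairingD phi F G) (pairing0 phi)).
Qed.

Lemma pairing_term phi c k : pairing phi (lterm c k) = c * phi k.
Proof.
rewrite (@pairing_widen [fset k]%fset) ?msuppU_le // big_seq_fset1.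
by rewrite mcoeffUU.
Qed.

Lemma pairing_mul_term phi c k F :
  pairing phi (lterm c k * F) = c * pairing (fun l => phi (k + l)) F.
Proof.
rewrite [in LHS](ltermE F) mulr_sumr pairing_sum [in RHS]/pairing mulr_sumr.
apply: eq_bigr => l _.
have -> : lterm c k * lterm F@_l l = lterm (c * F@_l) (k + l) by exact: lmul_term.
by rewrite pairing_term mulrA.
Qed.

Lemma leval1E F : leval1 F = pairing (fun=> 1) F.
Proof. by apply: eq_bigr => k _; rewrite mulr1. Qed.

End Functional.

Lemma ltermM (R : comNzRingType) (a b : R) k l :
  lterm a k * lterm b l = lterm (a * b) (k + l).
Proof. exact: lmul_term. Qed.

(** * Reduction of positive braid words *)

Definition below (m : nat) : seq nat -> bool := all (fun i => i < m)%N.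

Lemma below_notin m w : below m.+1 w -> m \notin w -> below m w.
Proof.
move=> /allP lt_w mw; apply/allP => i iw.
have := lt_w i iw; rewrite ltnS leq_eqVlt => /orP[/eqP im|//].
by rewrite -im iw in mw.
Qed.

Lemma below_count m w : below m w -> count_mem m w = 0%N.
Proof.
by move=> /allP lt_w; apply/count_memPn/negP => /lt_w; rewrite ltnn.
Qed.

Lemma below_pred m w : below m w -> m.-1 \notin w -> below m.-1 w.
Proof. by case: m => // m; apply: below_notin. Qed.

Lemma belowW m n w : (m <= n)%N -> below m w -> below n w.
Proof. by move=> le_mn; apply: sub_all => i /leq_trans; apply. Qed.

Lemma split_first (T : eqType) (k : T) w : k \in w ->
  exists x y, w = x ++ k :: y /\ k \notin x.
Proof.
elim: w => // i w IHw; rewrite inE.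
have [<- _|ki /= /IHw [x [y [-> kx]]]] := eqVneq k i; first by exists [::], w.
by exists (i :: x), y; rewrite inE negb_or ki.
Qed.

Lemma below_cat m x y : below m (x ++ y) = below m x && below m y.
Proof. exact: all_cat. Qed.

Lemma below_cons m i y : below m (i :: y) = (i < m)%N && below m y.
Proof. by []. Qed.

Lemma slide_generator (k : nat) (Q : seq nat -> Prop) :
    (forall x y i j, below k.+1 (x ++ [:: i, j & y]) -> (i.+1 < j)%N ->
       Q (x ++ [:: i, j & y]) <-> Q (x ++ [:: j, i & y])) ->
  forall x b y, below k.+1 x -> below k.-1 b -> below k.+1 y ->
    Q (x ++ b ++ k :: y) <-> Q (x ++ k :: b ++ y).
Proof.
move=> farQ x b; elim/last_ind: b => // b i IHb y xk.
rewrite -cats1 below_cat below_cons /= andbT => /andP[bk ltik] yk.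
rewrite -!catA /= -IHb ?below_cons ?yk ?andbT //; last by lia.
rewrite catA farQ ?catA // ?below_cat; last by lia.
rewrite xk (belowW _ bk) ?leqW ?leq_pred // !below_cons yk andbT /=.
by lia.
Qed.

(** The span of the words with at most one letter [m.-1] is the whole Hecke
    algebra, phrased for a property [Q] of words instead of a linear
    combination: the quadratic relation becomes the first closure condition.
    Between two consecutive letters k there is a word in smaller letters, which
    by induction contains k-1 at most once. Sliding the letters k towards each
    other yields either k k or k (k-1) k, and both can be traded for words with
    fewer letters k. *)
Lemma positive_word_reduction (m : nat) (Q : seq nat -> Prop) :
    (forall x y i, below m (x ++ i :: y) ->
       Q (x ++ i :: y) -> Q (x ++ y) -> Q (x ++ [:: i, i & y])) ->
    (forall x y i j, below m (x ++ [:: i, j & y]) -> (i.+1 < j)%N ->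
       Q (x ++ [:: i, j & y]) <-> Q (x ++ [:: j, i & y])) ->
    (forall x y i, below m (x ++ [:: i, i.+1 & y]) ->
       Q (x ++ [:: i, i.+1, i & y]) -> Q (x ++ [:: i.+1, i, i.+1 & y])) ->
    (forall w, below m w -> (count_mem m.-1 w <= 1)%N -> Q w) ->
  forall w, below m w -> Q w.
Proof.
elim: m Q => [|k IHk] Q sqQ farQ braidQ baseQ w; first by case: w => // _; apply: baseQ.
have [c] := ubnP (count_mem k w); elim: c w => // c IHc w ltc wk.
have [/(baseQ w wk) //|gt1] := leqP (count_mem k w) 1.
have : k \in w by rewrite -has_pred1 has_count; apply: ltnW.
case/split_first => x [w' [def_w kx]]; rewrite {w}def_w in ltc wk gt1 *.
move: wk ltc gt1; rewrite below_cat below_cons count_cat (count_memPn kx) /= eqxx add0n add1n.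
case/and3P=> xk _ w'k ltc gt1.
have : k \in w' by rewrite -has_pred1 has_count -ltnS.
case/split_first => a [y [def_w ka]]; rewrite {w'}def_w in ltc w'k gt1 *.
move: w'k ltc; rewrite below_cat below_cons count_cat (count_memPn ka) /= eqxx add0n add1n.
case/and3P=> ak _ yk ltc {gt1}.
have {ka}ak : below k a by apply: below_notin.
have slide := slide_generator farQ.
(* The induction hypothesis is used on the inner word only, in the context of
   the two letters k and of the outer words x and y. *)
move: ak; apply: (IHk (fun a => Q (x ++ k :: a ++ k :: y))) => [x' y' i|x' y' i j|x' y' i|].
- move: (sqQ (x ++ k :: x') (y' ++ k :: y) i).
  rewrite -!catA /= => sq; rewrite below_cat below_cons => /and3P[x'k ltik y'k].
  apply: sq; rewrite !(below_cat, below_cons) xk yk ltnSn !(belowW (leqnSn k)) //=.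
  by rewrite andbT leqW.
- move: (farQ (x ++ k :: x') (y' ++ k :: y) i j).
  rewrite -!catA /= => far; rewrite below_cat !below_cons => /and4P[x'k ltik ltjk y'k].
  apply: far; rewrite !(below_cat, below_cons) xk yk ltnSn !(belowW (leqnSn k)) //=.
  by rewrite andbT (leqW ltik) (leqW ltjk).
- move: (braidQ (x ++ k :: x') (y' ++ k :: y) i).
  rewrite -!catA /= => br; rewrite below_cat !below_cons => /and4P[x'k ltik ltjk y'k].
  apply: br; rewrite !(below_cat, below_cons) xk yk ltnSn !(belowW (leqnSn k)) //=.
  by rewrite andbT (leqW ltik) (leqW ltjk).
move=> {}a ak; case: (boolP (k.-1 \in a)) => [ka a1|ka _].
  (* The inner word is b (k-1) d: the braid relation removes one letter k. *)
  have def_k : k = k.-1.+1 by case: (k) ak ka => //; case: (a).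
  case/split_first: ka => b [d [def_a kb]]; rewrite {a}def_a in ak a1 *.
  move: ak a1; rewrite below_cat below_cons count_cat (count_memPn kb) /= eqxx.
  rewrite add0n add1n ltnS leqn0.
  case/and3P=> bk _ dk /eqP/count_memPn kd.
  have bk' := below_pred bk kb; have dk' := below_pred dk kd.
  have [bk1 dk1] := (belowW (leqnSn k) bk, belowW (leqnSn k) dk).
  have kk1 : (k.-1 < k.+1)%N by rewrite ltnS leq_pred.
  rewrite -catA /=; apply/slide => //.
    by rewrite !(below_cat, below_cons) ltnSn yk dk1 kk1.
  have [] := slide (x ++ b ++ [:: k; k.-1]) d y => //.
    by rewrite !(below_cat, below_cons) xk bk1 ltnSn kk1.
  rewrite -!catA /= => _; apply; rewrite catA {1 3}def_k; apply: braidQ.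
    by rewrite -def_k !(below_cat, below_cons) xk bk1 kk1 ltnSn dk1 yk.
  rewrite -def_k; apply: IHc; last first.
    by rewrite !(below_cat, below_cons) xk bk1 !kk1 ltnSn dk1 yk.
  have ne_k : (k.-1 == k) = false by apply/negbTE; rewrite {2}def_k neq_ltn leqnn.
  rewrite !count_cat /= !count_cat (count_memPn kx) (below_count bk) (below_count dk).
  by rewrite eqxx ne_k; move: ltc; clear; lia.
(* The inner word commutes with k: the two letters k become adjacent. *)
have {}ak' := below_pred ak ka; have ak1 := belowW (leqnSn k) ak.
apply/slide; rewrite ?below_cons ?ltnSn //.
rewrite catA; apply: sqQ.
- by rewrite !(below_cat, below_cons) xk yk ltnSn ak1.
- apply: IHc; last by rewrite !(below_cat, below_cons) xk yk ltnSn ak1.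
  by rewrite !count_cat /= (count_memPn kx) (below_count ak) ?eqxx; lia.
- apply: IHc; last by rewrite !(below_cat, below_cons) xk yk ak1.
  by rewrite !count_cat /= (count_memPn kx) (below_count ak) ?eqxx; lia.
Qed.
(** * Closures of braid words as diagrams *)

Definition run (s : seq bool) (D : diagram) : option (seq bool) :=
  foldl (fun os kx => obind (next_level^~ kx) os) (Some s) D.

Arguments run : simpl never.

Lemma run_cat s D1 D2 : run s (D1 ++ D2) = obind (run^~ D2) (run s D1).
Proof.
rewrite /run foldl_cat; case: (foldl _ (Some s) D1) => //=.
by elim: D2.
Qed.

Lemma run_cons s kx D : run s (kx :: D) = obind (run^~ D) (next_level s kx).
Proof. by rewrite -cat1s run_cat. Qed.

Lemma run_step s kx t D : next_level s kx = Some t -> run s (kx :: D) = run t D.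
Proof. by rewrite run_cons => ->. Qed.

(** The orientations met by a horizontal line that crosses the m strands and
    their m closing arcs: the strands run upwards and the arcs downwards. *)
Definition level m := nseq m true ++ nseq m false.

Lemma level_cup m : next_level (level m) (m, cup true) = Some (level m.+1).
Proof.
rewrite /= /level size_cat !size_nseq leq_addr drop_size_cat ?size_nseq //.
rewrite take_size_cat ?size_nseq //.
by rewrite -(addn1 m) nseqD -catA /= addn1.
Qed.

Lemma level_cap m : next_level (level m.+1) (m, cap) = Some (level m).
Proof.
have -> : level m.+1 = nseq m true ++ [:: true, false & nseq m false].
  by rewrite /level -{1}(addn1 m) nseqD -catA.
rewrite /= drop_size_cat ?size_nseq // take_size_cat ?size_nseq //.
Qed.

Lemma level_split m i : (i.+1 < m)%N ->
  level m = nseq i true ++ [:: true, true & nseq (m - i.+2) true ++ nseq m false].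
Proof.
move=> lt_im; have def_m : m = (i + (2 + (m - i.+2)))%N by lia.
by rewrite /level {1}def_m !nseqD -!catA.
Qed.

Lemma level_cross m i e : (i.+1 < m)%N ->
  next_level (level m) (i, cross e) = Some (level m).
Proof.
move/level_split=> ->.
by rewrite /= drop_size_cat ?size_nseq // take_size_cat ?size_nseq.
Qed.

(** Braid words with letters in [nat]: unlike [braid n], this type does not
    change with the number of strands, on which the induction runs. *)
Definition word := seq (nat * bool).
Definition cups n : diagram := [seq (k, cup true) | k <- iota 0 n].
Definition caps n : diagram := [seq (k, cap) | k <- rev (iota 0 n)].
Definition crossings (w : word) : diagram := [seq (x.1, cross x.2) | x <- w].
Definition close n (X : diagram) : diagram := cups n ++ X ++ caps n.
Definition closure n w := close n (crossings w).
Definition on_strands n : word -> bool := all (fun x => x.1.+1 < n)%N.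

Lemma cupsS n : cups n.+1 = cups n ++ [:: (n, cup true)].
Proof. by rewrite /cups -(addn1 n) iotaD map_cat. Qed.

Lemma capsS n : caps n.+1 = (n, cap) :: caps n.
Proof. by rewrite /caps -(addn1 n) iotaD rev_cat. Qed.

Lemma run_cups n : run [::] (cups n) = Some (level n).
Proof. by elim: n => // n IHn; rewrite cupsS run_cat IHn /= run_cons level_cup. Qed.

Lemma run_caps n : run (level n) (caps n) = Some [::].
Proof. by elim: n => // n IHn; rewrite capsS run_cons level_cap. Qed.

Lemma run_crossings n w : on_strands n w -> run (level n) (crossings w) = Some (level n).
Proof.
elim: w => // x w IHw /= /andP[lt_x /IHw IH].
by rewrite run_cons level_cross.
Qed.

Lemma close_link n X : run (level n) X = Some (level n) -> link_diagram (close n X).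
Proof.
move=> runX; apply/eqP; change (run [::] (close n X) = Some [::]).
by rewrite run_cat run_cups /= run_cat runX /= run_caps.
Qed.

Lemma closure_link n w : on_strands n w -> link_diagram (closure n w).
Proof. by move/run_crossings/close_link. Qed.

Lemma closeS n X : close n.+1 X = close n ((n, cup true) :: X ++ [:: (n, cap)]).
Proof. by rewrite /close cupsS capsS -!catA /= -catA. Qed.

Lemma crossings_cat u v : crossings (u ++ v) = crossings u ++ crossings v.
Proof. exact: map_cat. Qed.

Lemma on_strands_cat n u v : on_strands n (u ++ v) = on_strands n u && on_strands n v.
Proof. exact: all_cat. Qed.

Lemma on_strands_cons n x u : on_strands n (x :: u) = (x.1.+1 < n)%N && on_strands n u.
Proof. by []. Qed.

(** * Braid relations and Markov stabilisation as isotopies *)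

Section Invariance.
Variables (T : Type) (P : diagram -> T).
Hypothesis P_inv : link_invariant P.

(** Equality of the levels reached by [L] and [L'] is what makes both sides of
    the move link diagrams. *)
Lemma close_move n X L L' Y s : local_move L L' ->
    run (level n) X = Some s -> run s L = run s L' ->
    run s (L ++ Y) = Some (level n) ->
  P (close n (X ++ L ++ Y)) = P (close n (X ++ L' ++ Y)).
Proof.
move=> LL' runX eqL runY.
have runY' : run s (L' ++ Y) = Some (level n) by rewrite run_cat -eqL -run_cat.
have linkL : link_diagram (close n (X ++ L ++ Y)) by rewrite close_link ?run_cat ?runX.
have linkL' : link_diagram (close n (X ++ L' ++ Y)) by rewrite close_link ?run_cat ?runX.
move: linkL linkL'; rewrite /close -!catA !(catA (cups n)).
exact: P_inv.
Qed.

Lemma closure_move n a u v b : on_strands n (a ++ u ++ b) -> on_strands n v ->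
    local_move (crossings u) (crossings v) ->
  P (closure n (a ++ u ++ b)) = P (closure n (a ++ v ++ b)).
Proof.
rewrite !on_strands_cat => /and3P[an un bn] vn uv.
rewrite /closure !crossings_cat; apply: (close_move (s := level n)) => //.
- exact: run_crossings.
- by rewrite !run_crossings.
- by rewrite run_cat run_crossings //= run_crossings.
Qed.

Lemma closure_far n a b i j e e' : on_strands n (a ++ [:: (i, e), (j, e') & b]) ->
    (i.+1 < j)%N ->
  P (closure n (a ++ [:: (i, e), (j, e') & b])) = P (closure n (a ++ [:: (j, e'), (i, e) & b])).
Proof.
move=> wn lt_ij; apply: (@closure_move n a [:: (i, e); (j, e')] [:: (j, e'); (i, e)]) => //.
  by move: wn; rewrite on_strands_cat !on_strands_cons /= => /and4P[_ -> -> _].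
have := move_exchange i (j - i.+2) (cross e) (cross e').
by rewrite /= addn2 subnKC.
Qed.

Lemma closure_R2 n a b i e : on_strands n (a ++ (i, e) :: b) ->
  P (closure n (a ++ [:: (i, e), (i, ~~ e) & b])) = P (closure n (a ++ b)).
Proof.
rewrite on_strands_cat on_strands_cons /= => /and3P[an i_n bn].
apply: (@closure_move n a [:: (i, e); (i, ~~ e)] [::]) => //.
  by rewrite !on_strands_cat !on_strands_cons /= an i_n.
exact: move_R2.
Qed.

Lemma closure_R3 n a b i e : on_strands n (a ++ [:: (i, e), (i.+1, e) & b]) ->
  P (closure n (a ++ [:: (i, e), (i.+1, e), (i, e) & b]))
  = P (closure n (a ++ [:: (i.+1, e), (i, e), (i.+1, e) & b])).
Proof.
rewrite on_strands_cat !on_strands_cons /= => /and4P[an i_n i1_n bn].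
apply: (@closure_move n a [:: (i, e); (i.+1, e); (i, e)] [:: (i.+1, e); (i, e); (i.+1, e)]).
- by rewrite !on_strands_cat !on_strands_cons /= an i_n i1_n.
- by rewrite !on_strands_cons /= i_n i1_n.
- by apply: move_R3; rewrite eqxx.
Qed.

(** An extremum of the last strand has all the crossings of [a] on its left, so
    their heights can be exchanged. Used for the minimum and for the maximum. *)
Lemma slide_piece m p q n y X a Y :
    next_level (level p) (n, y) = Some (level q) -> (n <= p)%N -> (n <= q)%N ->
    on_strands n a ->
    run (level m) X = Some (level p) -> run (level q) Y = Some (level m) ->
  P (close m (X ++ (n, y) :: crossings a ++ Y)) = P (close m (X ++ crossings a ++ (n, y) :: Y)).
Proof.
move=> lev_y np nq; elim: a X => // -[i e] a IHa X /andP[/= i_n an] runX runY.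
have i_p := leq_trans i_n np; have i_q := leq_trans i_n nq.
have aq : on_strands q a by apply: sub_all an => z /leq_trans; apply.
have mv : local_move [:: (i, cross e); (n, y)] [:: (n, y); (i, cross e)].
  by have := move_exchange i (n - i.+2) (cross e) y; rewrite /= addn2 subnKC.
transitivity (P (close m ((X ++ [:: (i, cross e)]) ++ (n, y) :: crossings a ++ Y))).
  rewrite -catA; apply/esym.
  apply: (close_move (s := level p) (Y := crossings a ++ Y) mv) => //.
    rewrite (run_step _ (level_cross e i_p)) !(run_step _ lev_y).
    by rewrite (run_step _ (level_cross e i_q)).
  rewrite (run_step _ (level_cross e i_p)) (run_step _ lev_y).
  by rewrite run_cat run_crossings.
rewrite IHa // -?catA //.
by rewrite run_cat runX /= (run_step _ (level_cross e i_p)).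
Qed.

(** The minimum of the last strand slides up past [a] and its maximum slides
    down past [b]. Together with the single crossing between them they form the
    curl of a Reidemeister move I. *)
Lemma closure_stab n a b e : on_strands n.+1 (a ++ b) ->
  P (closure n.+2 (a ++ (n, e) :: b)) = P (closure n.+1 (a ++ b)).
Proof.
rewrite on_strands_cat => /andP[an bn].
rewrite /closure closeS !crossings_cat /= -catA.
have bn2 : on_strands n.+2 b by apply: sub_all bn => z /leqW.
rewrite (@slide_piece _ n.+1 n.+2 _ _ [::]) //; first 1 last.
- exact: level_cup.
- by rewrite /= run_cons level_cross //= run_cat run_crossings //= run_cons level_cap.
have := @slide_piece n.+1 n.+2 n.+1 n.+1 cap
  (crossings a ++ [:: (n.+1, cup true); (n, cross e)]) b [::] (level_cap _).
rewrite -!catA /= cats0 => <- //; last first.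
  by rewrite run_cat run_crossings //= run_cons level_cup /= run_cons level_cross.
apply: (close_move (s := level n.+1) (move_R1_r n true e)).
- exact: run_crossings.
- by rewrite run_cons level_cup /= run_cons level_cross //= run_cons level_cap.
- by rewrite run_cons level_cup /= run_cons level_cross //= run_cons level_cap /= run_crossings.
Qed.

End Invariance.

(** * Skein induction on closed braids *)

Definition positive (w : seq nat) : word := [seq (i, true) | i <- w].

Lemma positive_cat u v : positive (u ++ v) = positive u ++ positive v.
Proof. exact: map_cat. Qed.

Lemma on_strands_positive n w : on_strands n.+1 (positive w) = below n w.
Proof. by rewrite /on_strands all_map. Qed.

(** Any property of isotopy classes that holds for the unknot, and passes from
    two closed braids of a skein triple to the third, holds for closed braids. *)
Lemma closure_skein_ind (Q : diagram -> Prop) :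
    link_invariant Q -> Q unknot ->
    (forall n a b i, on_strands n (a ++ (i, true) :: b) ->
       let Qp := Q (closure n (a ++ (i, true) :: b)) in
       let Q0 := Q (closure n (a ++ b)) in
       let Qm := Q (closure n (a ++ (i, false) :: b)) in
       [/\ Q0 -> Qm -> Qp, Qp -> Q0 -> Qm & Qp -> Qm -> Q0]) ->
  forall n w, on_strands n.+1 w -> Q (closure n.+1 w).
Proof.
move=> Qinv Q1 skein.
(* Crossing changes reduce to positive words. *)
have signs n : (forall w, below n w -> Q (closure n.+1 (positive w))) ->
    forall w, on_strands n.+1 w -> Q (closure n.+1 w).
  move=> Qpos w.
  suff: forall x, below n x -> on_strands n.+1 w ->
      Q (closure n.+1 (positive x ++ w)).
    by move=> Qw; apply: (Qw [::]).
  elim: w => [|[i e] w IHw] x xn; first by rewrite cats0 => _; apply: Qpos.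
  case/andP=> /= i_n wn.
  have Qp : Q (closure n.+1 (positive x ++ (i, true) :: w)).
    have := IHw (x ++ [:: i]); rewrite positive_cat -catA; apply=> //.
    by rewrite below_cat xn below_cons andbT.
  case: e => //; have [|_ mQ _] := skein n.+1 (positive x) w i.
    by rewrite on_strands_cat on_strands_positive xn on_strands_cons i_n.
  by apply: mQ => //; apply: IHw.
elim=> [|n IHn]; apply: signs => w.
  by case: w.
apply: (positive_word_reduction (Q := fun w => Q (closure n.+2 (positive w)))) => {w}.
- move=> x y i; rewrite -on_strands_positive !positive_cat /= => wn Qx Q0.
  have [|pQ _ _] := skein n.+2 (positive x) ((i, true) :: positive y) i.
    by move: wn; rewrite !on_strands_cat !on_strands_cons => /and3P[-> -> ->].
  apply: pQ => //; rewrite (closure_R2 Qinv) //.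
  by move: wn; rewrite !on_strands_cat !on_strands_cons.
- move=> x y i j; rewrite -on_strands_positive !positive_cat /= => wn ij.
  by rewrite (closure_far Qinv wn).
- move=> x y i; rewrite -on_strands_positive !positive_cat /= => wn.
  by rewrite (closure_R3 Qinv).
move=> w wn; rewrite /= leq_eqVlt ltnS leqn0 => /orP[w1|/eqP/count_memPn nw].
  have : n \in w by rewrite -has_pred1 has_count (eqP w1).
  case/split_first=> a [b [def_w na]]; rewrite {w}def_w in wn w1 *.
  move: wn w1; rewrite below_cat below_cons count_cat (count_memPn na) /= eqxx add0n add1n eqSS.
  case/and3P=> an _ bn /eqP/count_memPn nb.
  have abn : on_strands n.+1 (positive a ++ positive b).
    by rewrite on_strands_cat !on_strands_positive (below_notin an na) (below_notin bn nb).
  by rewrite positive_cat /= (closure_stab Qinv) //; apply: IHn.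
(* The last strand closes to a split unknot: the link is the smoothed member of
   a skein triple whose two other members are stabilisations of the braid
   without that strand. *)
have wn' : on_strands n.+1 (positive w) by rewrite on_strands_positive below_notin.
have [|_ _ Q0] := skein n.+2 (positive w) [::] n.
  by rewrite on_strands_cat on_strands_positive wn on_strands_cons /= ltnSn.
rewrite cats0 in Q0; apply: Q0.
  by rewrite (closure_stab Qinv) ?cats0 //; apply: IHn.
by rewrite (closure_stab Qinv) ?cats0 //; apply: IHn.
Qed.

(** * The specialisation of the Homflypt polynomial to 1 *)

Section Homflypt.
Variable P : diagram -> Zvz.
Hypothesis HP : homflypt P.

Let P_inv : link_invariant P. Proof. by case: HP. Qed.

Let C := conwayC P.
Let z := zpow 1.

Lemma closure_skein n a b i : on_strands n (a ++ (i, true) :: b) ->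
  P (closure n (a ++ (i, true) :: b))
  = vpow 1 * zconst z * P (closure n (a ++ b))
    + vpow 2 * P (closure n (a ++ (i, false) :: b)).
Proof.
move=> wn; have linkp := closure_link wn; move: wn.
rewrite on_strands_cat on_strands_cons => /and3P[an /= i_n bn].
case: HP => _ _ /(_ (cups n ++ crossings a) (crossings b ++ caps n)).
move=> /(_ (nseq i true) (nseq (n - i.+2) true ++ nseq n false) true true).
rewrite /= size_nseq -(level_split i_n) -!catA /=.
move: linkp; rewrite /closure /close !crossings_cat /= -!catA /= => linkp; apply => //.
by rewrite [LHS](_ : _ = run [::] (cups n ++ crossings a)) // run_cat run_cups /= run_crossings.
Qed.

Lemma zpowK (F : Zz) : zpow (-1) * (z * F) = F.
Proof. by rewrite mulrA ltermM mulr1 mul1r. Qed.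

Lemma pairing_vpow phi k F : pairing phi (vpow k * F) = pairing (fun l => phi (k + l)) F.
Proof. by rewrite /vpow pairing_mul_term mul1r. Qed.

Lemma pairing_zconst phi c F : pairing phi (zconst c * F) = c * pairing phi F.
Proof.
rewrite /zconst pairing_mul_term; congr (_ * _).
by apply: eq_pairing => l; rewrite add0r.
Qed.

(** Multiplying by a power of v shifts the argument of the functional: hence
    the skein relation for P holds for any linear functional of P, with shifts. *)
Lemma pairing_skein phi n a b i : on_strands n (a ++ (i, true) :: b) ->
  pairing phi (P (closure n (a ++ (i, true) :: b)))
  = z * pairing (fun k => phi (1 + k)) (P (closure n (a ++ b)))
    + pairing (fun k => phi (2 + k)) (P (closure n (a ++ (i, false) :: b))).
Proof.
move=> wn; rewrite (closure_skein wn) pairingD -mulrA.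
rewrite [X in X + _ = _]pairing_vpow [X in _ + X = _]pairing_vpow.
by rewrite [X in X + _ = _]pairing_zconst.
Qed.

Lemma pairing1 phi : pairing phi (1 : Zvz) = phi 0.
Proof. by rewrite [1](_ : _ = lterm 1 0) // pairing_term mul1r. Qed.

Lemma conwayCE p : C p = pairing (fun=> 1) (P (closure 2 (nseq `|p| (0%N, 0 <= p)))).
Proof.
rewrite /C /conwayC /conway leval1E; congr (pairing _ (P _)).
by rewrite /closure /close /sigma1_pow /braid_closure /crossings !map_nseq.
Qed.

Lemma unknot_closure : closure 1 [::] = unknot. Proof. by []. Qed.

Lemma conwayC_pm1 (e : bool) : pairing (fun=> 1) (P (closure 2 [:: (0%N, e)])) = 1 :> Zz.
Proof.
rewrite (closure_stab P_inv (a := [::]) (b := [::])) // unknot_closure.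
by case: HP => _ -> _; rewrite pairing1.
Qed.

(** A skein triple of powers of s_1. For nonzero p, one of the three words
    contains a cancelling pair of letters: it is the one with the negative
    crossing if p > 0 and the one with the positive crossing if p < 0. *)
Lemma conwayC_rec (p : int) : C (p + 1) = z * C p + C (p - 1).
Proof.
rewrite !conwayCE; case: p => [[|q]|q].
- by rewrite (@pairing_skein _ 2 [::] [::] 0).
- have -> : absz (q.+1%:Z + 1) = q.+2 by lia.
  have -> : absz (q.+1%:Z - 1) = q by lia.
  have -> : (0 <= q.+1%:Z - 1) = true by lia.
  rewrite (@pairing_skein _ 2 [::] (nseq q.+1 (0%N, true)) 0) /=; last first.
    by rewrite /on_strands all_nseq /= orbT.
  by rewrite (closure_R2 P_inv (a := [::])) // /on_strands /= all_nseq orbT.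
- have -> : absz (Negz q + 1) = q by lia.
  have -> : absz (Negz q - 1) = q.+2 by lia.
  have -> : (0 <= Negz q - 1) = false by lia.
  have -> : nseq q (0%N, 0 <= Negz q + 1) = nseq q (0%N, false).
    by case: q => // q; congr nseq; congr pair; lia.
  have wn : on_strands 2 (nseq q (0%N, false)) by rewrite /on_strands all_nseq orbT.
  rewrite -(closure_R2 P_inv (a := [::]) (i := 0) (e := true)) //.
  by rewrite (@pairing_skein _ 2 [::] (nseq q.+1 (0%N, false)) 0).
Qed.

Lemma conwayC1 : C 1 = 1. Proof. by rewrite conwayCE conwayC_pm1. Qed.
Lemma conwayCN1 : C (- 1) = 1. Proof. by rewrite conwayCE conwayC_pm1. Qed.

(** The closure of s_1^0 is the unlink of two components: the skein relation
    gives z C_0 = C_1 - C_(-1) = 0, and z is invertible. *)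
Lemma conwayC0 : C 0 = 0.
Proof.
rewrite -[LHS]zpowK; have := conwayC_rec 0.
rewrite add0r sub0r conwayC1 conwayCN1 -[1 in LHS]add0r => /addIr <-.
by rewrite mulr0.
Qed.

Lemma conwayCN (k : nat) : C (- k%:Z) = (-1) ^+ k.+1 * C k.
Proof.
suff: C (- k%:Z) = (-1) ^+ k.+1 * C k /\ C (- k.+1%:Z) = (-1) ^+ k.+2 * C k.+1 by case.
elim: k => [|k [IH1 IH2]].
  by rewrite oppr0 conwayC0 conwayCN1 conwayC1 mulr0 sqrrN expr1n mulr1.
split=> //.
have := conwayC_rec (- k.+1%:Z); have := conwayC_rec k.+1.
have -> : - k.+1%:Z + 1 = - k%:Z by lia.
have -> : - k.+1%:Z - 1 = - k.+2%:Z by lia.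
have -> : k.+1%:Z + 1 = k.+2%:Z by lia.
have -> : k.+1%:Z - 1 = k%:Z by lia.
rewrite IH1 IH2 => ->; rewrite !exprS => E.
have -> : C (- k.+2%:Z) = (-1) * (-1) ^+ k * C k - z * (-1 * (-1 * (-1) ^+ k) * C k.+1).
  by rewrite E; ring.
by ring.
Qed.

(** The substitution 1/v - v = z sends P to 1: with x = 1/v, the equation for [m]
    compares the coefficients of x in x^m P and in x^m, on the basis (x, 1) of
    Z[z, 1/z][x] / (x^2 - z x - 1). *)
Definition specializes_to_1 (D : diagram) : Prop :=
  forall m : int, pairing (fun k => C (m - k)) (P D) = C m.

Lemma closure_specializes n w : on_strands n.+1 w -> specializes_to_1 (closure n.+1 w).
Proof.
apply: closure_skein_ind.
- by move=> D1 L L' D2 LL' l1 l2; rewrite /specializes_to_1 (P_inv LL' l1 l2).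
- by move=> m; case: HP => _ -> _; rewrite pairing1 subr0.
move=> {}n a b i wn Qp Q0 Qm.
have skein (m : int) : pairing (fun k => C (m - k)) (P (closure n (a ++ (i, true) :: b)))
  = z * pairing (fun k => C (m - 1 - k)) (P (closure n (a ++ b)))
    + pairing (fun k => C (m - 2 - k)) (P (closure n (a ++ (i, false) :: b))).
  apply: etrans (pairing_skein _ wn) _.
  by apply: f_equal2; [apply: (f_equal (fun F => z * F))|];
    apply: eq_pairing => k; rewrite opprD addrA.
have recC (m : int) : C m = z * C (m - 1) + C (m - 2).
  by have := conwayC_rec (m - 1); rewrite subrK -addrA.
split.
- by move=> q0 qm m; rewrite skein q0 qm -recC.
- move=> qp q0 m; have := skein (m + 2); rewrite qp q0 recC => /addrI.
  by rewrite addrK.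
- move=> qp qm m; have := skein (m + 1); rewrite qp qm recC => /addIr.
  by rewrite addrK => /(congr1 ( *%R (zpow (-1)))); rewrite !zpowK.
Qed.

End Homflypt.

(** * Solving for the first three coefficients *)

Lemma big_ord_split3 (V : zmodType) n (F : nat -> V) :
    (forall j, (n <= j)%N -> F j = 0) ->
  \sum_(j < n) F j = F 0%N + F 1%N + F 2%N + \sum_(3 <= j < n) F j.
Proof.
move=> F0.
have tail k m : (n <= k)%N -> \sum_(k <= j < m) F j = 0.
  by move=> nk; rewrite big_nat big1 // => j /andP[kj _]; apply/F0/(leq_trans nk).
have -> : \sum_(j < n) F j = \sum_(0 <= j < n + 3) F j.
  by rewrite (big_cat_nat (n := n)) ?leq_addr //= (tail n) // addr0 big_mkord.
have -> : \sum_(3 <= j < n) F j = \sum_(3 <= j < n + 3) F j.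
  case: (leqP 3 n) => n3; last by rewrite big_geq ?tail // ltnW.
  by rewrite [RHS](big_cat_nat (n := n)) ?leq_addr //= (tail n) ?addr0.
by rewrite addn3 [LHS]big_ltn // big_ltn // big_ltn // !addrA.
Qed.

Lemma braid_closureE n (beta : braid n) :
  braid_closure beta = closure n [seq (nat_of_ord x.1, x.2) | x <- beta].
Proof. by rewrite /closure /crossings -map_comp. Qed.

Lemma braid_on_strands n (beta : braid n) :
  on_strands n [seq (nat_of_ord x.1, x.2) | x <- beta].
Proof.
by rewrite /on_strands all_map; apply/allP => x _ /=; case: n beta x => [|n] beta [[i lt_i] e].
Qed.

Lemma pairing_mfw (R : comNzRingType) phi s n (h : seq R) :
  pairing phi (lterm 1 s * \sum_(j < n) lterm h`_j 0 * lterm 1 (2 * j%:Z))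
  = \sum_(j < n) h`_j * phi (s + 2 * j%:Z).
Proof.
rewrite pairing_mul_term mul1r pairing_sum; apply: eq_bigr => j _.
by rewrite ltermM pairing_term mulr1 add0r.
Qed.

Theorem theorem2p1 (P : diagram -> Zvz) (HP : homflypt P)
    (n : nat) (Hn : (1 <= n)%N) (beta : braid n) (h : n.-tuple Zz)
    (Hh : P (braid_closure beta) = vpow (writhe beta - n%:Z + 1)
            * \sum_(j < n) zconst h`_j * vpow (2 * j%:Z)) :
  let w := writhe beta in
  let C := conwayC P in
  let nabla := conway P (braid_closure beta) in
  let q0 := \sum_(3 <= j < n) zpow (-2) * (C (2 * j%:Z - 3) - 1) * h`_j in
  let q1 := \sum_(3 <= j < n) h`_j in
  let q2 := \sum_(3 <= j < n) zpow (-2) * (C (2 * j%:Z - 1) - 1) * h`_j in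
  [/\ h`_0 = zpow (-2) * (C (w + 4 - n%:Z) - nabla) - q0,
      h`_1 = nabla - h`_0 - h`_2 - q1
    & h`_2 = zpow (-2) * (C (w + 2 - n%:Z) - nabla) - q2].
Proof.
move=> w C nabla q0 q1 q2.
have h0 j : (n <= j)%N -> h`_j = 0 by move=> nj; rewrite nth_default ?size_tuple.
have nablaE : nabla = h`_0 + h`_1 + h`_2 + q1.
  rewrite /nabla /conway leval1E Hh pairing_mfw.
  rewrite -(big_ord_split3 (F := fun j => h`_j)) //.
  by apply: eq_bigr => j _; rewrite mulr1.
(* The lowest exponent of v in the expansion is w - n + 1, hence the shift of m.
   With r = 3 and r = 1 the index r - 2 j stays odd, and the coefficients of
   h_0, h_1, h_2 are C_3, 1, 1 and 1, 1, C_3. *)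
have spec r : C (w - n%:Z + 1 + r)
    = h`_0 * C r + h`_1 * C (r - 2) + h`_2 * C (r - 4)
      + \sum_(3 <= j < n) h`_j * C (r - 2 * j%:Z).
  have wn := braid_on_strands beta.
  have := closure_specializes HP (n := n.-1); rewrite prednK // => /(_ _ wn).
  move=> /(_ (w - n%:Z + 1 + r)); rewrite -braid_closureE Hh pairing_mfw -/C => <-.
  pose c (j : nat) := C (w - n%:Z + 1 + r - (w - n%:Z + 1 + 2 * j%:Z)).
  rewrite (big_ord_split3 (F := fun j => h`_j * c j)) /c.
    have E (j : nat) : w - n%:Z + 1 + r - (w - n%:Z + 1 + 2 * j%:Z) = r - 2 * j%:Z by ring.
    by rewrite !E subr0; congr (_ + _); apply: eq_bigr => j _; rewrite E.
  by move=> j /h0 ->; rewrite mul0r.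
have C1 : C 1 = 1 := conwayC1 HP; have CN1 : C (-1) = 1 := conwayCN1 HP.
have C3 : C 3 = zpow 1 * zpow 1 + 1.
  have := conwayC_rec HP 2; have := conwayC_rec HP 1.
  by rewrite (conwayC0 HP) -/C C1 addr0 mulr1 => ->.
have Codd (k : nat) : C (- (2 * k%:Z + 1)) = C (2 * k%:Z + 1).
  have := conwayCN HP (k.*2.+1); rewrite -signr_odd /= odd_double /= expr0 mul1r.
  by have -> : (k.*2.+1)%:Z = 2 * k%:Z + 1 by lia.
have CN3 : C (-3) = C 3 by have := Codd 1%N.
have zz : zpow (-2) * (zpow 1 * zpow 1) = 1 by rewrite !ltermM !mulr1.
have q1E : q1 = nabla - h`_0 - h`_1 - h`_2 by rewrite nablaE; ring.
have qE (f : nat -> Zz) : \sum_(3 <= j < n) zpow (-2) * (f j - 1) * h`_j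
    = zpow (-2) * (\sum_(3 <= j < n) h`_j * f j - q1).
  rewrite /q1 -sumrB mulr_sumr; apply: eq_bigr => j _; ring.
split; last 2 first.
- by rewrite nablaE; ring.
(* In (iii) and (i) the factor z^2 = C_3 - 1 of the unknown is cancelled by
   writing 1 as z^(-2) z^2 in front of it. *)
- rewrite /q2 qE; have -> : \sum_(3 <= j < n) h`_j * C (2 * j%:Z - 1)
    = \sum_(3 <= j < n) h`_j * C (1 - 2 * j%:Z).
    rewrite !big_nat; apply: eq_bigr => -[//|j] _; congr (_ * _).
    have -> : 2 * j.+1%:Z - 1 = 2 * j%:Z + 1 by lia.
    by rewrite -Codd; congr C; lia.
  have -> : w + 2 - n%:Z = w - n%:Z + 1 + 1 by ring.
  rewrite spec C1 (_ : 1 - 2 = -1) // CN1 (_ : 1 - 4 = -3) // CN3 C3 q1E.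
  by rewrite -[LHS]mul1r -[X in X * _ = _]zz; ring.
- rewrite /q0 qE; have -> : \sum_(3 <= j < n) h`_j * C (2 * j%:Z - 3)
    = \sum_(3 <= j < n) h`_j * C (3 - 2 * j%:Z).
    rewrite !big_nat; apply: eq_bigr => -[|[|j]] // _; congr (_ * _).
    have -> : 2 * j.+2%:Z - 3 = 2 * j%:Z + 1 by lia.
    by rewrite -Codd; congr C; lia.
  have -> : w + 4 - n%:Z = w - n%:Z + 1 + 3 by ring.
  rewrite spec C3 (_ : 3 - 2 = 1) // C1 (_ : 3 - 4 = -1) // CN1 q1E.
  by rewrite -[LHS]mul1r -[X in X * _ = _]zz; ring.
Qed.
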